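(* Let $d$ be a nonzero real number. Let $\Phi=\{\phi^1,\dots,\phi^r\}$, $\Psi=\{\psi^1,\dots,\psi^s\}$, $\tilde\Phi=\{\tilde\phi^1,\dots,\tilde\phi^r\}$, $\tilde\Psi=\{\tilde\psi^1,\dots,\tilde\psi^s\}$ be subsets of $L_2(\mathbb R)$. Suppose that $WS_J(\Phi;\Psi)$ is a frame in $L_2(\mathbb R)$ for some integer $J$, that is, there are positive constants $C_1$ and $C_2$ such that $$( * )\qquad C_1\|f\|_{L_2(\mathbb R)}^2\le\sum_{\ell=1}^r\sum_{k\in\mathbb Z}|\langle f,\phi^\ell_{d^J;k}\rangle|^2+\sum_{j=J}^\infty\sum_{\ell=1}^s\sum_{k\in\mathbb Z}|\langle f,\psi^\ell_{d^j;k}\rangle|^2\le C_2\|f\|_{L_2(\mathbb R)}^2,\qquad f\in L_2(\mathbb R).$$ Then $( * )$ holds for all integers $J$. If in addition $|d|>1$, then $WS(\Psi)$ must be a frame in $L_2(\mathbb R)$ with the same frame bounds, satisfying $$C_1\|f\|_{L_2(\mathbb R)}^2\le\sum_{j\in\mathbb Z}\sum_{\ell=1}^s\sum_{k\in\mathbb Z}|\langle f,\psi^\ell_{d^j;k}\rangle|^2\le C_2\|f\|_{L_2(\mathbb R)}^2,\qquad f\in L_2(\mathbb R).$$ If $|d|>1$ and the pair $(WS_J(\Phi;\Psi),WS_J(\tilde\Phi;\tilde\Psi))$ forms a pair of nonhomogeneous dual wavelet frames in $(L_2(\mathbb R),L_2(\mathbb R))$ for some integer $J$, then $(WS(\Psi),WS(\tilde\Psi))$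 forms a pair of homogeneous dual wavelet frames in $L_2(\mathbb R)$, that is, both $WS(\Psi)$ and $WS(\tilde\Psi)$ are frames in $L_2(\mathbb R)$ and $$\langle f,g\rangle=\sum_{j\in\mathbb Z}\sum_{\ell=1}^s\sum_{k\in\mathbb Z}\langle f,\psi^\ell_{d^j;k}\rangle\langle\tilde\psi^\ell_{d^j;k},g\rangle,\qquad f,g\in L_2(\mathbb R),$$ with the series converging absolutely.
   Context: $\langle f,g\rangle=\int_{\mathbb R}f\overline g$ on $L_2(\mathbb R)$. For $\lambda\ne0$, $f_{\lambda;k}(x):=|\lambda|^{1/2}f(\lambda x-k)$. ''Sets'' of generators are finite families whose elements need not be distinct; sums run over them with multiplicity. $$WS_J(\Phi;\Psi):=\{\phi_{d^J;k}:k\in\mathbb Z,\phi\in\Phi\}\cup\{\psi_{d^j;k}:j\ge J,k\in\mathbb Z,\psi\in\Psi\},\qquad WS(\Psi):=\{\psi_{d^j;k}:j\in\mathbb Z,k\in\mathbb Z,\psi\in\Psi\}.$$ The pair $(WS_J(\Phi;\Psi),WS_J(\tilde\Phi;\tilde\Psi))$ forms a pair of nonhomogeneous dual wavelet frames in $(L_2(\mathbb R),L_2(\mathbb R))$ if both $WS_J(\Phi;\Psi)$ and $WS_J(\tilde\Phi;\tilde\Psi)$ are frames in $L_2(\mathbb R)$ and, for all $f,g\in L_2(\mathbb R)$, $$\langle f,g\rangle=\sum_{\ell=1}^r\sum_{k\in\mathbb Z}\langle f,\phi^\ell_{d^J;k}\rangle\langle\tilde\phi^\ell_{d^J;k},g\rangle+\sum_{j=J}^\infty\sum_{\ell=1}^s\sum_{k\in\mathbb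 Z}\langle f,\psi^\ell_{d^j;k}\rangle\langle\tilde\psi^\ell_{d^j;k},g\rangle$$ with the series on the right converging absolutely. *)

(* Defs.v *)
From HB Require Import structures.
From mathcomp Require Import all_boot all_order all_algebra.
From mathcomp Require Import all_classical all_reals all_analysis.
From mathcomp Require Import complex.
Set Implicit Arguments.
Unset Strict Implicit.
Unset Printing Implicit Defensive.
Import Order.TTheory GRing.Theory Num.Theory.
Local Open Scope classical_set_scope.
Local Open Scope ring_scope.
Local Open Scope complex_scope.

Local Notation leb R := (@lebesgue_measure R).
Local Notation cabs z := (Normc.normc z).

Section L2.
Variable R : realType.

Definition L2norm (f : R -> R[i]) : \bar R :=
  Lnorm (leb R) 2%:E (fun x => (cabs (f x))%:E).

(* Elements of L_2(R) are represented by functions, not by classes modulo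
   almost-everywhere equality; everything below is invariant under that
   equality. *)
Definition L2 : set (R -> R[i]) :=
  [set f | [/\ measurable_fun setT (fun x => complex.Re (f x)),
               measurable_fun setT (fun x => complex.Im (f x))
             & (L2norm f < +oo)%E]].

Definition cintegral (h : R -> R[i]) : R[i] :=
  Rintegral (leb R) setT (fun x => complex.Re (h x))
  +i* Rintegral (leb R) setT (fun x => complex.Im (h x)).

Definition inner (f g : R -> R[i]) : R[i] :=
  cintegral (fun x => f x * (g x)^*).

Definition dilshift (f : R -> R[i]) (lambda : R) (k : int) : R -> R[i] :=
  fun x => (Num.sqrt `|lambda|)%:C * f (lambda * x - k%:~R).

End L2.

Section AbsSum.
Variables (R : realType) (I : choiceType).

(* Value of an absolutely convergent series; meaningless (a default value)
   otherwise, so it is always used together with absolute convergence. *)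
Definition rsum (D : set I) (u : I -> R) : R :=
  fine (\esum_(i in D) (Num.max (u i) 0)%:E) -
  fine (\esum_(i in D) (Num.max (- u i) 0)%:E).

Definition csum (D : set I) (u : I -> R[i]) : R[i] :=
  rsum D (fun i => complex.Re (u i)) +i* rsum D (fun i => complex.Im (u i)).

End AbsSum.

Section WaveletSystems.
Variables (R : realType) (d : R) (r s : nat).
Implicit Types (Phi : 'I_r -> R -> R[i]) (Psi : 'I_s -> R -> R[i]) (J : int).

Definition nonhom_frame_bounds J Phi Psi (C1 C2 : R) : Prop :=
  forall f, L2 f ->
  let total := (\sum_(l < r) \esum_(k in [set: int])
              (cabs (inner f (dilshift (Phi l) (d ^ J) k)) ^+ 2)%:E
          + \esum_(j in [set j : int | (J <= j)%R]) \sum_(l < s)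
              \esum_(k in [set: int])
              (cabs (inner f (dilshift (Psi l) (d ^ j) k)) ^+ 2)%:E)%E in
  (C1%:E * L2norm f ^+ 2 <= total)%E /\ (total <= C2%:E * L2norm f ^+ 2)%E.

Definition nonhom_frame J Phi Psi : Prop :=
  exists C1 C2 : R, [/\ 0 < C1, 0 < C2 & nonhom_frame_bounds J Phi Psi C1 C2].

Definition hom_frame_bounds Psi (C1 C2 : R) : Prop :=
  forall f, L2 f ->
  let total := (\esum_(j in [set: int]) \sum_(l < s) \esum_(k in [set: int])
              (cabs (inner f (dilshift (Psi l) (d ^ j) k)) ^+ 2)%:E)%E in
  (C1%:E * L2norm f ^+ 2 <= total)%E /\ (total <= C2%:E * L2norm f ^+ 2)%E.

Definition hom_frame Psi : Prop :=
  exists C1 C2 : R, [/\ 0 < C1, 0 < C2 & hom_frame_bounds Psi C1 C2].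

(* The summand <f, eta_{d^j;k}> <eta~_{d^j;k}, g>. *)
Definition dual_term (f g eta teta : R -> R[i]) (j k : int) : R[i] :=
  inner f (dilshift eta (d ^ j) k) * inner (dilshift teta (d ^ j) k) g.

Definition nonhom_dual_frames J Phi Psi tPhi tPsi : Prop :=
  [/\ nonhom_frame J Phi Psi, nonhom_frame J tPhi tPsi &
  forall f g, L2 f -> L2 g ->
    (\sum_(l < r) \esum_(k in [set: int])
        (cabs (dual_term f g (Phi l) (tPhi l) J k))%:E
     + \esum_(j in [set j : int | (J <= j)%R]) \sum_(l < s)
        \esum_(k in [set: int])
        (cabs (dual_term f g (Psi l) (tPsi l) j k))%:E < +oo)%E
    /\
    inner f g =
      \sum_(l < r) csum [set: int] (dual_term f g (Phi l) (tPhi l) J)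
      + csum [set j : int | J <= j] (fun j => \sum_(l < s)
          csum [set: int] (dual_term f g (Psi l) (tPsi l) j))].

Definition hom_dual_frames Psi tPsi : Prop :=
  [/\ hom_frame Psi, hom_frame tPsi &
  forall f g, L2 f -> L2 g ->
    (\esum_(j in [set: int]) \sum_(l < s) \esum_(k in [set: int])
        (cabs (dual_term f g (Psi l) (tPsi l) j k))%:E < +oo)%E
    /\
    inner f g =
      csum [set: int] (fun j => \sum_(l < s)
        csum [set: int] (dual_term f g (Psi l) (tPsi l) j))].

End WaveletSystems.

(* Main.v *)
Require Import Defs.
From HB Require Import structures.
From mathcomp Require Import all_boot all_order all_algebra.
From mathcomp Require Import all_classical all_reals all_analysis.
From mathcomp Require Import measurable_realfun complex.
From mathcomp Require Import ring lra zify.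

(** The dilation by a power of [d] is unitary on L2 and permutes the levels of
    a wavelet system.  Hence a frame inequality, or a dual expansion, that
    starts at one level [J] holds with the same constants at every level
    ([nonhom_frame_bounds_shift], [reproduces_shift]).

    When [`|d| > 1], one lets [J] tend to -oo.  The levels from [J] upwards then
    exhaust all the integers, and everything reduces to showing that the energy
    carried by the generators [Phi] at level [J] tends to zero
    ([scaling_energy_vanish]).  The frame inequalities, now known for all [J],
    contain a Bessel bound for these generators that does not depend on [J].
    It makes the contribution of the tail of [f] small uniformly in [J], so
    that [f] may be taken supported in some [-N, N].  For such an [f] the
    Cauchy-Schwarz inequality and a change of variable bound the sum over all
    translates by the energy of [f] times the integral of |phi|^2 over the
    points at distance less than [`|d ^ J| * N] from the integers
    ([coef_energy_trunc_le]); the balls involved are disjoint as soon as their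
    radius is at most 1/2.  These neighbourhoods shrink to the integers, a null
    set, so the integral tends to zero.

    The homogeneous frame bounds follow at once ([hom_frame_bounds_limit]).  For
    a dual pair, |a b| <= |a|^2 + |b|^2 dominates the terms of the expansion by
    the energies of the two frames.  This gives absolute convergence of the
    homogeneous expansion, and shows that the [Phi] part of the nonhomogeneous
    one tends to zero ([hom_reproduces]). *)

Set Implicit Arguments.
Unset Strict Implicit.
Unset Printing Implicit Defensive.
Import Order.TTheory GRing.Theory Num.Theory.
Local Open Scope classical_set_scope.
Local Open Scope ring_scope.

Local Notation mu := lebesgue_measure.
Local Notation cabs z := (Normc.normc z).

(** * Modulus of a complex number *)

Section Modulus.
Variable R : realType.
Implicit Types z w : R[i].

Lemma cabs_ge0 z : 0 <= cabs z.
Proof. by case: z => a b /=; exact: sqrtr_ge0. Qed.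

Lemma cabs_sqr z : cabs z ^+ 2 = complex.Re z ^+ 2 + complex.Im z ^+ 2.
Proof. by case: z => a b /=; rewrite sqr_sqrtr// addr_ge0// sqr_ge0. Qed.

Lemma cabs_conj z : cabs (z^*) = cabs z.
Proof. by case: z => a b /=; rewrite sqrrN. Qed.

Lemma ReD z w : complex.Re (z + w) = complex.Re z + complex.Re w.
Proof. by case: z; case: w. Qed.

Lemma ImD z w : complex.Im (z + w) = complex.Im z + complex.Im w.
Proof. by case: z; case: w. Qed.

Lemma Re_mul_conj z w : complex.Re (z * w^*) =
  complex.Re z * complex.Re w + complex.Im z * complex.Im w.
Proof. by case: z => a b; case: w => c d /=; ring. Qed.

Lemma Im_mul_conj z w : complex.Im (z * w^*) =
  complex.Im z * complex.Re w - complex.Re z * complex.Im w.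
Proof. by case: z => a b; case: w => c d /=; ring. Qed.

Lemma normr_Re_le z : `|complex.Re z| <= cabs z.
Proof.
by rewrite -(ler_pXn2r (ltn0Sn 1)) ?nnegrE ?cabs_ge0// real_normK ?num_real//
  cabs_sqr lerDl sqr_ge0.
Qed.

Lemma normr_Im_le z : `|complex.Im z| <= cabs z.
Proof.
by rewrite -(ler_pXn2r (ltn0Sn 1)) ?nnegrE ?cabs_ge0// real_normK ?num_real//
  cabs_sqr lerDr sqr_ge0.
Qed.

Lemma cabsD_sqr_le z w : cabs (z + w) ^+ 2 <= 2 * cabs z ^+ 2 + 2 * cabs w ^+ 2.
Proof.
rewrite !cabs_sqr; case: z => a b; case: w => c d /=.
have := sqr_ge0 (a - c); have := sqr_ge0 (b - d); nra.
Qed.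

Lemma cabs_mul_le z w : cabs (z * w) <= cabs z ^+ 2 + cabs w ^+ 2.
Proof.
rewrite Normc.normcM; have := cabs_ge0 z; have := cabs_ge0 w.
have := sqr_ge0 (cabs z - cabs w); nra.
Qed.

End Modulus.

(** * Affine changes of variable in the Lebesgue integral *)

Section Affine.
Variable R : realType.
Variables (a t : R) (a_neq0 : a != 0).

Let T : R -> measurableTypeR R := fun x => a * x - t.

Lemma measurable_affine : measurable_fun [set: R] (fun x : R => a * x - t).
Proof.
apply: measurable_funB; last exact: measurable_cst.
by apply: measurable_funM => //; exact: measurable_cst.
Qed.

(** Both sides are measures in [A], so it suffices to compare them on
    half-open intervals; a negative slope turns `]x, y] into an interval
    closed on the other side, whence the two cases. *)
Lemma lebesgue_measure_affine (A : set R) : measurable A ->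
  mu A = (`|a|%:E * mu (T @^-1` A))%E.
Proof.
move=> mA; have mT : measurable_fun [set: measurableTypeR R] T.
  exact: measurable_affine.
pose m : {measure set (measurableTypeR R) -> \bar R} :=
  mscale (NngNum (normr_ge0 a))
    (measure_function_pushforward__canonical__measure_function_Measure mu mT).
rewrite -[RHS]/(m A).
apply: lebesgue_measure_unique => //= _ [[x y]] _ <-.
rewrite /mscale/= /pushforward.
have [a0|a0|a0] := ltgtP a 0; last by have := a_neq0; rewrite a0 eqxx.
- rewrite [X in (_ * mu X)%E](_ : _ = `[(y + t) / a, (x + t) / a[%classic); last first.
    apply/seteqP; split => z /=; rewrite /T !in_itv/= => /andP[h1 h2]; apply/andP; split.
    + by rewrite ler_ndivrMr//; lra.
    + by rewrite ltr_ndivlMr//; lra.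
    + by move: h2; rewrite ltr_ndivlMr//; lra.
    + by move: h1; rewrite ler_ndivrMr//; lra.
  rewrite !lebesgue_measure_itv/= !lte_fin ltr_ndivrMr// divfK ?lt_eqF// ltrD2r.
  case: ifP => _; last by rewrite mule0.
  by rewrite -!EFinB -EFinM ltr0_norm//; congr EFin; field.
- rewrite [X in (_ * mu X)%E](_ : _ = `](x + t) / a, (y + t) / a]%classic); last first.
    apply/seteqP; split => z /=; rewrite /T !in_itv/= => /andP[h1 h2]; apply/andP; split.
    + by rewrite ltr_pdivrMr//; lra.
    + by rewrite ler_pdivlMr//; lra.
    + by move: h1; rewrite ltr_pdivrMr//; lra.
    + by move: h2; rewrite ler_pdivlMr//; lra.
  rewrite !lebesgue_measure_itv/= !lte_fin ltr_pdivrMr// divfK ?gt_eqF// ltrD2r.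
  case: ifP => _; last by rewrite mule0.
  by rewrite -!EFinB -EFinM gtr0_norm//; congr EFin; field.
Qed.

Lemma ge0_integral_affine (D : set R) (h : R -> \bar R) :
  measurable D -> measurable_fun D h -> (forall x, D x -> 0 <= h x)%E ->
  (\int[mu]_(x in D) h x =
   `|a|%:E * \int[mu]_(x in T @^-1` D) h (a * x - t)%R)%E.
Proof.
move=> mD mh h0.
have mT : measurable_fun [set: measurableTypeR R] T by exact: measurable_affine.
rewrite (eq_measure_integral (mscale (NngNum (normr_ge0 a)) (pushforward mu T)));
  last by move=> A mA _; exact: lebesgue_measure_affine.
rewrite ge0_integral_mscale//=; congr (_ * _)%E.
rewrite ge0_integral_pushforward// => x /set_mem; exact: h0.
Qed.

(** The nonnegative case applied to the positive and negative parts.  The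
    Jacobian stays under the integral sign, so that the identity holds for
    every measurable function and integrability is never an issue. *)
Lemma Rintegral_affine (h : R -> R) : measurable_fun setT h ->
  Rintegral mu setT h = Rintegral mu setT (fun x => `|a| * h (a * x - t)).
Proof.
move=> /measurable_EFinP mh.
have mT : measurable_fun [set: R] (fun x : R => a * x - t) by exact: measurable_affine.
rewrite /Rintegral integralE [in RHS]integralE/=; congr fine.
rewrite (ge0_integral_affine measurableT) //; last exact: measurable_funepos.
rewrite [X in (_ - X)%E](ge0_integral_affine measurableT)//; last exact: measurable_funeneg.
rewrite preimage_setT -!ge0_integralZl//=.
- congr (_ - _)%E; apply: eq_integral => x _.
  + by rewrite !funeposE/= maxe_pMr// mule0.
  + by rewrite !funenegE/= maxe_pMr// mule0 -EFinM mulrN.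
- exact: (measurableT_comp (measurable_funeneg mh) mT).
- exact: (measurableT_comp (measurable_funepos mh) mT).
Qed.

End Affine.

(** * Energy and inner product of square-integrable functions *)

Section Energy.
Variable R : realType.
Implicit Types (f g eta : R -> R[i]) (D A : set R) (lambda c : R).

(** The squared L2 norm of [f] on [D], as an integral rather than as the
    square of a root: restriction, rescaling and limits are statements about
    integrals. *)
Definition energy D f : \bar R := (\int[mu]_(x in D) (cabs (f x) ^+ 2)%:E)%E.

Definition cmeasurable f :=
  measurable_fun setT (fun x => complex.Re (f x)) /\
  measurable_fun setT (fun x => complex.Im (f x)).

Lemma energy_ge0 D f : (0 <= energy D f)%E.
Proof. by apply: integral_ge0 => x _; rewrite lee_fin sqr_ge0. Qed.

Lemma L2norm_sqr f : (L2norm f ^+ 2)%E = energy setT f.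
Proof.
have two_neq0 : 2 != 0 :> R by rewrite pnatr_eq0.
have := @poweR_Lnorm _ _ _ lebesgue_measure (fun x => (cabs (f x))%:E) 2 two_neq0.
have p2 (y : \bar R) : (0 <= y)%E -> (y `^ 2 = y ^+ 2)%E.
  case: y => [y||] //; rewrite ?lee_fin => y0.
    by rewrite poweR_EFin powR_mulrn.
  by rewrite expe2 mulyy poweRyr// pnatr_eq0.
rewrite /L2norm p2 ?Lnorm_ge0// => ->.
apply: eq_integral => x _; rewrite gee0_abs ?lee_fin ?cabs_ge0//.
by rewrite poweR_EFin powR_mulrn ?cabs_ge0.
Qed.

Lemma L2_energy f : L2 f <-> cmeasurable f /\ (energy setT f < +oo)%E.
Proof.
rewrite -L2norm_sqr /L2/=; split => [[mr mi foo]|[[mr mi] foo]]; split => //.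
- by rewrite -expe2 ltey_eq fin_numX// ge0_fin_numE// Lnorm_ge0.
- rewrite ltey; apply/negP => /eqP E; move: foo.
  by rewrite E mulyy.
Qed.

Lemma measurable_cabs_sqr f : cmeasurable f ->
  measurable_fun setT (fun x => (cabs (f x) ^+ 2)%:E : \bar R).
Proof.
move=> [mr mi]; apply/measurable_EFinP.
rewrite (_ : (fun x => _) =
  (fun x => complex.Re (f x) ^+ 2 + complex.Im (f x) ^+ 2)); last first.
  by apply/funext => x; rewrite cabs_sqr.
by apply: measurable_funD; exact: measurable_funX.
Qed.

Lemma measurable_cabs f : cmeasurable f ->
  measurable_fun setT (fun x => cabs (f x)).
Proof.
move=> mf; rewrite (_ : (fun x => _) = (fun x => Num.sqrt (cabs (f x) ^+ 2))).
  apply: (measurableT_comp (f := @Num.sqrt R)).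
    by apply: continuous_measurable_fun; exact: sqrt_continuous.
  by apply/measurable_EFinP; exact: measurable_cabs_sqr.
by apply/funext => x; rewrite sqrtr_sqr ger0_norm// cabs_ge0.
Qed.

Lemma energy_setS D A f : cmeasurable f -> measurable D -> measurable A ->
  D `<=` A -> (energy D f <= energy A f)%E.
Proof.
move=> mf mD mA DA; apply: ge0_subset_integral => //.
- by apply: measurable_funTS; exact: measurable_cabs_sqr.
- by move=> x _; rewrite lee_fin sqr_ge0.
Qed.

Lemma cmeasurable_dilshift f lambda k : cmeasurable f ->
  cmeasurable (dilshift f lambda k).
Proof.
move=> [mr mi].
have H h : measurable_fun setT h ->
    measurable_fun setT (fun x => Num.sqrt `|lambda| * h (lambda * x - k%:~R)).
  move=> mh; apply: measurable_funM => //.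
  by apply: (measurableT_comp mh); exact: measurable_affine.
split; [move: (H _ mr)|move: (H _ mi)]; congr measurable_fun; apply/funext => x.
- by rewrite /dilshift; case: (f _) => a b /=; rewrite mul0r subr0.
- by rewrite /dilshift; case: (f _) => a b /=; rewrite mul0r addr0.
Qed.

(** A localized form of the unitarity of dilations and translations: the
    part of the dilated function seen on the preimage of [D] is the part of
    [f] seen on [D]. *)
Lemma energy_dilshift D f lambda k : lambda != 0 -> cmeasurable f ->
  measurable D ->
  energy [set x | D (lambda * x - k%:~R)] (dilshift f lambda k) = energy D f.
Proof.
move=> l0 mf mD.
rewrite [RHS](ge0_integral_affine (k%:~R) l0)//; last 2 first.
- by apply: measurable_funTS; exact: measurable_cabs_sqr.
- by move=> x _; rewrite lee_fin sqr_ge0.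
have mf' := measurable_cabs_sqr mf.
rewrite -ge0_integralZl//=.
- apply: eq_integral => x _; rewrite /dilshift Normc.normcM exprMn EFinM.
  by congr (_%:E * _)%E; rewrite cabs_sqr/= expr0n/= addr0 sqr_sqrtr.
- rewrite -[X in measurable X]setTI.
  exact: (@measurable_affine R lambda k%:~R measurableT _ mD).
- apply: measurable_funTS.
  apply: (measurableT_comp mf'); exact: measurable_affine.
- by move=> x _; rewrite lee_fin sqr_ge0.
Qed.

Lemma energy_dilshiftT f lambda k : lambda != 0 -> cmeasurable f ->
  energy setT (dilshift f lambda k) = energy setT f.
Proof. by move=> l0 mf; rewrite -(energy_dilshift k l0 mf measurableT). Qed.

Lemma L2_dilshift f lambda k : lambda != 0 -> L2 f -> L2 (dilshift f lambda k).
Proof.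
move=> l0 /L2_energy[mf foo]; apply/L2_energy; split.
  exact: cmeasurable_dilshift.
by rewrite energy_dilshiftT.
Qed.

Lemma dilshift_dilshift eta a b k : dilshift (dilshift eta a k) b 0 = dilshift eta (a * b) k.
Proof.
apply/funext => x; rewrite /dilshift subr0 mulrA mulrA; congr (_ * _).
by rewrite normrM sqrtrM// mulrC rmorphM.
Qed.

Lemma integrable_cabsM f g : L2 f -> L2 g ->
  mu.-integrable setT (EFin \o (fun x => cabs (f x) * cabs (g x))).
Proof.
move=> /L2_energy[mf foo] /L2_energy[mg goo].
have I h : cmeasurable h -> (energy setT h < +oo)%E ->
    mu.-integrable setT (EFin \o (fun x => cabs (h x) ^+ 2)).
  move=> mh hoo; apply/integrableP; split; first exact: measurable_cabs_sqr.
  apply: le_lt_trans hoo; apply: ge0_le_integral => //.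
  - by apply: measurableT_comp => //; exact: measurable_cabs_sqr.
  - exact: measurable_cabs_sqr.
  - by move=> x _ /=; rewrite ger0_norm// sqr_ge0.
apply: (le_integrable measurableT _ _ (integrableD measurableT (I _ mf foo) (I _ mg goo))).
- by apply/measurable_EFinP; apply: measurable_funM; exact: measurable_cabs.
- move=> x _ /=; rewrite lee_fin ger0_norm ?mulr_ge0 ?cabs_ge0//.
  rewrite ger0_norm ?addr_ge0 ?sqr_ge0// -Normc.normcM; exact: cabs_mul_le.
Qed.

Let measurable_Re_inner f g : cmeasurable f -> cmeasurable g ->
  measurable_fun setT (fun x => complex.Re (f x * (g x)^*)).
Proof.
move=> [fr fi] [gr gi].
rewrite (_ : (fun x => _) = (fun x => complex.Re (f x) * complex.Re (g x) +
   complex.Im (f x) * complex.Im (g x))); last first.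
  by apply/funext => x; exact: Re_mul_conj.
by apply: measurable_funD; exact: measurable_funM.
Qed.

Let measurable_Im_inner f g : cmeasurable f -> cmeasurable g ->
  measurable_fun setT (fun x => complex.Im (f x * (g x)^*)).
Proof.
move=> [fr fi] [gr gi].
rewrite (_ : (fun x => _) = (fun x => complex.Im (f x) * complex.Re (g x) -
   complex.Re (f x) * complex.Im (g x))); last first.
  by apply/funext => x; exact: Im_mul_conj.
by apply: measurable_funB; exact: measurable_funM.
Qed.

Lemma integrable_Re_inner f g : L2 f -> L2 g ->
  mu.-integrable setT (EFin \o (fun x => complex.Re (f x * (g x)^*))).
Proof.
move=> Lf Lg; have [mf _] := (L2_energy f).1 Lf; have [mg _] := (L2_energy g).1 Lg.
apply: (le_integrable measurableT _ _ (integrable_cabsM Lf Lg)).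
  by apply/measurable_EFinP; exact: measurable_Re_inner.
move=> x _ /=; rewrite lee_fin [leRHS]ger0_norm ?mulr_ge0 ?cabs_ge0//.
by rewrite -(cabs_conj (g x)) -Normc.normcM normr_Re_le.
Qed.

Lemma integrable_Im_inner f g : L2 f -> L2 g ->
  mu.-integrable setT (EFin \o (fun x => complex.Im (f x * (g x)^*))).
Proof.
move=> Lf Lg; have [mf _] := (L2_energy f).1 Lf; have [mg _] := (L2_energy g).1 Lg.
apply: (le_integrable measurableT _ _ (integrable_cabsM Lf Lg)).
  by apply/measurable_EFinP; exact: measurable_Im_inner.
move=> x _ /=; rewrite lee_fin [leRHS]ger0_norm ?mulr_ge0 ?cabs_ge0//.
by rewrite -(cabs_conj (g x)) -Normc.normcM normr_Im_le.
Qed.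

Lemma inner_dilshift f g lambda k : lambda != 0 -> L2 f -> L2 g ->
  inner (dilshift f lambda k) (dilshift g lambda k) = inner f g.
Proof.
move=> l0 /L2_energy[mf _] /L2_energy[mg _]; rewrite /inner /cintegral.
rewrite [in RHS](Rintegral_affine (k%:~R) l0 (measurable_Re_inner mf mg)).
rewrite [in RHS](Rintegral_affine (k%:~R) l0 (measurable_Im_inner mf mg)).
congr (Complex _ _); apply: eq_Rintegral => x _.
- rewrite !Re_mul_conj /dilshift.
  case: (f _) => a b; case: (g _) => c d /=.
  have := sqr_sqrtr (normr_ge0 lambda); set q := Num.sqrt _ => <-; ring.
- rewrite !Im_mul_conj /dilshift.
  case: (f _) => a b; case: (g _) => c d /=.
  have := sqr_sqrtr (normr_ge0 lambda); set q := Num.sqrt _ => <-; ring.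
Qed.

Lemma inner_conj f g : L2 f -> L2 g -> inner f g = (inner g f)^*.
Proof.
move=> Lf Lg; rewrite /inner /cintegral/=; congr (Complex _ _).
  by apply: eq_Rintegral => x _; rewrite !Re_mul_conj; ring.
rewrite -mulN1r -RintegralZl//; last exact: integrable_Im_inner.
by apply: eq_Rintegral => x _; rewrite !Im_mul_conj; ring.
Qed.

Lemma cabs_innerC f g : L2 f -> L2 g -> cabs (inner f g) = cabs (inner g f).
Proof. by move=> Lf Lg; rewrite inner_conj// cabs_conj. Qed.

Lemma innerDl f1 f2 g : L2 f1 -> L2 f2 -> L2 g ->
  inner (fun x => f1 x + f2 x) g = inner f1 g + inner f2 g.
Proof.
move=> L1 L2' Lg; rewrite /inner /cintegral.
rewrite [RHS]/GRing.add/=; congr (Complex _ _).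
- rewrite -RintegralD//; try exact: integrable_Re_inner.
  by apply: eq_Rintegral => x _; rewrite mulrDl ReD.
- rewrite -RintegralD//; try exact: integrable_Im_inner.
  by apply: eq_Rintegral => x _; rewrite mulrDl ImD.
Qed.

(** Hoelder's inequality bounds the real and the imaginary part separately;
    recombining them costs the factor 2, which is harmless where the estimate
    serves to show that something tends to zero. *)
Lemma inner_cauchy f g : L2 f -> L2 g ->
  ((cabs (inner f g) ^+ 2)%:E <= 2%:E * (energy setT f * energy setT g))%E.
Proof.
move=> Lf Lg; have ifg := integrable_cabsM Lf Lg.
have [mf foo] := (L2_energy f).1 Lf; have [mg goo] := (L2_energy g).1 Lg.
pose P := Rintegral mu setT (fun x => cabs (f x) * cabs (g x)).
have ReP : `|complex.Re (inner f g)| <= P.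
  apply: (le_trans (le_normr_Rintegral measurableT (integrable_Re_inner Lf Lg))).
  apply: le_Rintegral => //; first exact/integrable_norm/integrable_Re_inner.
  by move=> x _; rewrite (le_trans (normr_Re_le _))// Normc.normcM cabs_conj.
have ImP : `|complex.Im (inner f g)| <= P.
  apply: (le_trans (le_normr_Rintegral measurableT (integrable_Im_inner Lf Lg))).
  apply: le_Rintegral => //; first exact/integrable_norm/integrable_Im_inner.
  by move=> x _; rewrite (le_trans (normr_Im_le _))// Normc.normcM cabs_conj.
have P0 : 0 <= P := le_trans (normr_ge0 _) ReP.
have PE : (P%:E <= L2norm f * L2norm g)%E.
  have half : (2^-1 + 2^-1 = 1 :> R) by lra.
  have := hoelder lebesgue_measure (measurable_cabs mf) (measurable_cabs mg)
    (ltr0Sn R 1) (ltr0Sn R 1) half.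
  apply: le_trans; rewrite Lnorm1 /P /Rintegral fineK//; last exact: integrable_fin_num.
  rewrite le_eqVlt; apply/orP; left; apply/eqP; apply: eq_integral => x _ /=.
  by rewrite ger0_norm// mulr_ge0 ?cabs_ge0.
rewrite -!L2norm_sqr !expe2 muleACA.
apply: (@le_trans _ _ (2%:E * (P%:E * P%:E))%E).
  rewrite -!EFinM lee_fin cabs_sqr -(real_normK (num_real (complex.Re _))).
  rewrite -(real_normK (num_real (complex.Im _))) mulr_natl mulr2n.
  by apply: lerD; rewrite expr2; apply: ler_pM.
by rewrite lee_wpmul2l// lee_pmul// lee_fin.
Qed.

End Energy.

(** * Coefficients at coarse scales *)

Section Vanishing.
Variable R : realType.
Implicit Types (f g eta : R -> R[i]) (D A : set R) (lambda c : R).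

Definition trunc D f : R -> R[i] := fun x => if x \in D then f x else 0.

Lemma trunc_split D f : f = (fun x => trunc D f x + trunc (~` D) f x).
Proof.
apply/funext => x; rewrite /trunc in_setC; case: ifP => /= _.
  by rewrite addr0.
by rewrite add0r.
Qed.

Lemma cmeasurable_trunc D f : measurable D -> cmeasurable f ->
  cmeasurable (trunc D f).
Proof.
move=> mD [mr mi]; have mI : measurable_fun setT (fun x : R => x \in D).
  apply: (measurable_fun_bool true); rewrite setTI.
  rewrite (_ : _ @^-1` _ = D)//; apply/seteqP; split => x /=; first by move/set_mem.
  by move/mem_set.
split; rewrite /trunc.
- rewrite (_ : (fun x => _) = (fun x => if x \in D then complex.Re (f x) else 0)).
    by apply: measurable_fun_ifT => //; exact: measurable_cst.
  by apply/funext => x; case: ifP.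
- rewrite (_ : (fun x => _) = (fun x => if x \in D then complex.Im (f x) else 0)).
    by apply: measurable_fun_ifT => //; exact: measurable_cst.
  by apply/funext => x; case: ifP.
Qed.

Lemma energy_trunc D f : energy setT (trunc D f) = energy D f.
Proof.
rewrite /energy [RHS]integral_mkcond; apply: eq_integral => x _.
by rewrite patchE /trunc; case: ifP => // _; rewrite Normc.normc0 expr0n.
Qed.

Lemma L2_trunc D f : measurable D -> L2 f -> L2 (trunc D f).
Proof.
move=> mD /L2_energy[mf foo]; apply/L2_energy; split.
  exact: cmeasurable_trunc.
by rewrite energy_trunc; apply: le_lt_trans foo; exact: energy_setS.
Qed.

(** Absolute continuity of the integral: the integrands restricted to [E n]
    are dominated by that of [f] and tend to zero almost everywhere. *)
Lemma energy_cvg0 (E : nat -> set R) f : L2 f -> (forall n, measurable (E n)) ->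
  {ae mu, forall x, \forall n \near \oo, ~ E n x} ->
  (energy (E n) f @[n --> \oo] --> 0)%E.
Proof.
move=> /L2_energy[mf foo] mE aeE.
have mf2 := measurable_cabs_sqr mf.
have f20 (x : R) : (0 <= (cabs (f x) ^+ 2)%:E :> \bar R)%E by rewrite lee_fin sqr_ge0.
pose u n := (fun x => (cabs (f x) ^+ 2)%:E : \bar R) \_ (E n).
have mu_ n : measurable_fun setT (u n).
  by apply: (measurable_restrictT _ (mE n)).1; apply: measurable_funTS.
have u_cvg : {ae mu, forall x, [set: R] x -> u ^~ x @ \oo --> (cst 0%E : R -> \bar R) x}.
  apply: (filterS (Filter := ae_filter_ringOfSetsType mu)) aeE => x xE _; apply: cvg_near_cst.
  near=> n; have nE : ~ E n x by near: n.
  by rewrite /u patchE memNset.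
have u_dom : {ae mu, forall x n, [set: R] x -> (`|u n x| <= (cabs (f x) ^+ 2)%:E)%E}.
  apply: aeW => x n _; rewrite /u patchE; case: ifP => _.
    by rewrite gee0_abs.
  by rewrite abse0.
have if2 : mu.-integrable setT (fun x => (cabs (f x) ^+ 2)%:E : \bar R).
  apply/integrableP; split => //; apply: le_lt_trans foo.
  by under eq_integral => x _ do rewrite gee0_abs//.
have [_ _] := @dominated_convergence _ (measurableTypeR R) R mu setT measurableT u
  (cst 0%E) _ mu_ (measurable_cst _) u_cvg if2 u_dom.
rewrite integral0; apply: cvg_trans; apply: near_eq_cvg.
by near=> n; rewrite /energy [RHS]integral_mkcond.
Unshelve. all: by end_near.
Qed.

Lemma energy_small (E : nat -> set R) f : L2 f -> (forall n, measurable (E n)) ->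
  {ae mu, forall x, \forall n \near \oo, ~ E n x} ->
  forall eps : R, 0 < eps -> exists n, (energy (E n) f < eps%:E)%E.
Proof.
move=> Lf mE aeE eps e0; have cE := energy_cvg0 Lf mE aeE.
have [n _ /(_ n (leqnn n)) H] :=
  cE _ (@nbhs_open_ereal_lt R 0 (fun=> eps) e0).
by exists n.
Qed.

Lemma measurable_normr_lt c : measurable [set x : R | `|x| < c].
Proof.
rewrite (_ : [set x | _] = `]- c, c[%classic); first exact: measurable_itv.
by apply/seteqP; split => x /=; rewrite in_itv/= ltr_norml.
Qed.

Lemma energy_tail f : L2 f -> forall eps : R, 0 < eps ->
  exists N : nat, (energy (~` [set x : R | (`|x| < N%:R)%R]) f < eps%:E)%E.
Proof.
move=> Lf eps e0.
apply: (energy_small (E := fun N => ~` [set x : R | `|x| < N%:R])) => //.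
  by move=> N; apply: measurableC; exact: measurable_normr_lt.
by apply: aeW => x; near=> n => /=; apply; near: n; exact: nbhs_infty_gtr.
Unshelve. all: by end_near.
Qed.

Definition near_integers c : set R := [set y | exists k : int, `|y + k%:~R| < c].

Definition ball_integer c (k : int) : set R := [set y | `|y + k%:~R| < c].

Lemma measurable_ball_integer c k : measurable (ball_integer c k).
Proof.
rewrite (_ : ball_integer c k = `]- c - k%:~R, c - k%:~R[%classic).
  exact: measurable_itv.
apply/seteqP; split => x /=; rewrite /ball_integer/= in_itv/= ltr_norml.
  by move=> /andP[h1 h2]; apply/andP; split; lra.
by move=> /andP[h1 h2]; apply/andP; split; lra.
Qed.

Lemma near_integersE c : near_integers c = \bigcup_k ball_integer c k.
Proof.
by apply/seteqP; split => [y [k yk]|y [k _ yk]]; exists k.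
Qed.

Lemma measurable_near_integers c : measurable (near_integers c).
Proof.
rewrite near_integersE; apply: countable_bigcupT_measurable.
  exact: countableP.
by move=> k; exact: measurable_ball_integer.
Qed.

(** The neighbourhoods of the integers shrink to the set of integers, which is
    countable and hence null.  The radii 1 / (n + 2) are at most 1/2, so that
    the balls are disjoint. *)
Lemma energy_near_integers f : L2 f -> forall eps : R, 0 < eps ->
  exists n : nat, (energy (near_integers n.+2%:R^-1) f < eps%:E)%E.
Proof.
move=> Lf eps e0.
apply: (energy_small (E := fun n => near_integers n.+2%:R^-1)) => //.
  by move=> N; exact: measurable_near_integers.
have cZ : countable (range (fun k : int => k%:~R : R)).
  exact: sub_countable (card_image_le _ _) (countableP _).
exists (range (fun k : int => k%:~R)); split.
- by apply: countable_measurable cZ => t; exact: measurable_set1.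
- exact: countable_lebesgue_measure0.
- move=> /= x nE; apply: contrapT => nZ; apply: nE.
  have /andP[fx1 fx2] := floor_itv x; set m := Num.floor x in fx1 fx2.
  rewrite intrD in fx2.
  have mx : m%:~R != x by apply/eqP => mx; apply: nZ; exists m.
  have fx1' : m%:~R < x by rewrite lt_neqAle mx.
  (* A non-integer [x] stays away from the integers by its distance to the
     two closest ones. *)
  have d0 : 0 < Num.min (x - m%:~R) (m%:~R + 1 - x).
    by rewrite lt_min subr_gt0 fx1' subr_gt0.
  near=> n => -[k].
  have : n.+1%:R^-1 < Num.min (x - m%:~R) (m%:~R + 1 - x).
    by near: n; exact: (near_infty_natSinv_lt (PosNum d0)).
  have : n.+2%:R^-1 <= n.+1%:R^-1 :> R.
    by rewrite lef_pV2 ?posrE// ler_nat.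
  rewrite lt_min => c1 /andP[c2 c3]; rewrite ltr_norml => /andP[c4 c5].
  move: c1 c2 c3 c4 c5; move: (n.+1%:R^-1) (n.+2%:R^-1) => c c' c1 c2 c3 c4 c5.
  have [mk|mk] := leP 0 (m + k).
    have : 0 <= (m + k)%:~R :> R by rewrite ler0z.
    rewrite intrD => mk0; clear -c1 c2 c4 c5 mk0; lra.
  have : (m + k)%:~R <= (-1)%:~R :> R by rewrite ler_int -ltzD1 addNr.
  rewrite intrD => mk0; clear -c1 c3 c4 c5 mk0; lra.
Unshelve. all: by end_near.
Qed.

Lemma ball_integer_disjoint c (D : set int) : c <= 2^-1 -> trivIset D (ball_integer c).
Proof.
move=> c2 i j _ _ [y [/= yi yj]].
move: yi yj; rewrite /ball_integer/= !ltr_norml => /andP[a1 a2] /andP[b1 b2].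
have h1 : (i - j)%:~R < 1%:~R :> R by rewrite intrD intrN; lra.
have h2 : (-1)%:~R < (i - j)%:~R :> R by rewrite intrD intrN; lra.
by move: h1 h2; rewrite !ltr_int; lia.
Qed.

(** For [c <= 1/2] the balls around distinct integers are disjoint, so their
    energies add up to the energy of a subset of [near_integers c]. *)
Lemma esum_energy_balls c f : cmeasurable f -> c <= 2^-1 ->
  (\esum_(k in [set: int]) energy (ball_integer c k) f <=
   energy (near_integers c) f)%E.
Proof.
move=> mf c2; apply: ge_ereal_sup => _ [X [finX _] <-]; rewrite fsbig_finite//=.
have mU : measurable (\big[setU/set0]_(k <- finmap.enum_fset (fset_set X)) ball_integer c k).
  by apply: bigsetU_measurable => k _; exact: measurable_ball_integer.
rewrite -(@ge0_integral_bigsetU _ _ _ mu _ (ball_integer c))//=.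
- apply: energy_setS => //; first exact: measurable_near_integers.
  by rewrite -bigcup_seq => y [k _ yk]; exists k.
- by move=> k; exact: measurable_ball_integer.
- exact: finmap.fset_uniq.
- exact: ball_integer_disjoint.
- by apply: measurable_funTS; exact: measurable_cabs_sqr.
- by move=> x _; rewrite lee_fin sqr_ge0.
Qed.

(** The contribution of a single generator at the dilation [lambda] to the
    frame sum of [f]. *)
Definition coef_energy f eta lambda : \bar R :=
  (\esum_(k in [set: int]) (cabs (inner f (dilshift eta lambda k)) ^+ 2)%:E)%E.

Lemma coef_energy_ge0 f eta lambda : (0 <= coef_energy f eta lambda)%E.
Proof. by apply: esum_ge0 => k _; rewrite lee_fin sqr_ge0. Qed.

Lemma esum_scale_le (I : choiceType) (D : set I) (a : I -> \bar R) (x : \bar R) :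
  (0 <= x)%E -> (forall i, 0 <= a i)%E ->
  (\esum_(i in D) (x * a i) <= x * \esum_(i in D) a i)%E.
Proof.
move=> x0 a0; apply: ge_ereal_sup => _ [X [finX XD] <-].
rewrite -ge0_mule_fsumr//; apply: lee_wpmul2l => //.
by apply: esum_ge; exists X.
Qed.

Lemma inner_truncl D f g : inner (trunc D f) g = inner (trunc D f) (trunc D g).
Proof.
rewrite /inner; congr cintegral; apply/funext => x; rewrite /trunc.
by case: ifP => // _; rewrite !mul0r.
Qed.

(** Only the values of the dilated generator on the support of the truncation
    enter the coefficients.  Undoing the dilation moves this support to a ball
    of radius [`|lambda| * N] around an integer, and these balls are disjoint
    once the radius is at most 1/2.  Thus at coarse scales the coefficients see
    the generator only near the integers. *)
Lemma coef_energy_trunc_le f eta lambda (N : nat) : lambda != 0 -> L2 f -> L2 eta ->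
  `|lambda| * N%:R <= 2^-1 ->
  (coef_energy (trunc [set x : R | (`|x| < N%:R)%R] f) eta lambda <=
   2%:E * (energy setT f * energy (near_integers (`|lambda| * N%:R)) eta))%E.
Proof.
move=> l0 Lf Le c2; set A := [set x | _].
have mA : measurable A by exact: measurable_normr_lt.
have [mf _] := (L2_energy f).1 Lf; have [me _] := (L2_energy eta).1 Le.
have Ef0 := energy_ge0 setT f.
apply: (@le_trans _ _ (\esum_(k in [set: int]) ((2%:E * energy setT f) *
    energy (ball_integer (`|lambda| * N%:R) k) eta))%E).
  apply: le_esum => k _; rewrite inner_truncl.
  apply: (le_trans (inner_cauchy _ _)); rewrite ?muleA.
  - exact: L2_trunc.
  - by apply: L2_trunc => //; exact: L2_dilshift.
  rewrite !energy_trunc -muleA -[leRHS]muleA; apply: lee_wpmul2l => //.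
  apply: lee_pmul; [exact: energy_ge0|exact: energy_ge0| |].
    exact: energy_setS.
  rewrite -(energy_dilshift k l0 me (measurable_ball_integer _ _)).
  rewrite le_eqVlt; apply/orP; left; apply/eqP; congr energy.
  apply/seteqP; split => x; rewrite /A /ball_integer/= subrK normrM.
    by rewrite ltr_pM2l ?normr_gt0.
  by rewrite ltr_pM2l ?normr_gt0.
rewrite muleA; apply: le_trans (esum_scale_le _ _ _) _.
- by rewrite mule_ge0.
- by move=> k; exact: energy_ge0.
apply: lee_wpmul2l; first by rewrite mule_ge0.
exact: esum_energy_balls.
Qed.

Lemma coef_energyD_le f1 f2 eta lambda : lambda != 0 -> L2 f1 -> L2 f2 -> L2 eta ->
  (coef_energy (fun x => f1 x + f2 x)%R eta lambda <=
   2%:E * coef_energy f1 eta lambda + 2%:E * coef_energy f2 eta lambda)%E.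
Proof.
move=> l0 L1 L2' Le.
have sq0 (z : R[i]) : (0 <= (cabs z ^+ 2)%:E)%E by rewrite lee_fin sqr_ge0.
apply: (@le_trans _ _ (\esum_(k in [set: int])
   (2%:E * (cabs (inner f1 (dilshift eta lambda k)) ^+ 2)%:E +
    2%:E * (cabs (inner f2 (dilshift eta lambda k)) ^+ 2)%:E))%E).
  apply: le_esum => k _; rewrite innerDl//; last exact: L2_dilshift.
  rewrite -!EFinM -EFinD lee_fin; exact: cabsD_sqr_le.
rewrite esumD; last 2 first.
- by move=> k _; rewrite mule_ge0.
- by move=> k _; rewrite mule_ge0.
by apply: leeD; apply: esum_scale_le.
Qed.

Lemma near_integersS c c' : c <= c' -> near_integers c `<=` near_integers c'.
Proof. by move=> cc y [k yk]; exists k; exact: lt_le_trans yk cc. Qed.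

(** Under a Bessel bound uniform in the dilation, the coefficients tend to
    zero as [lambda] does: the tail of [f] far from the origin contributes
    little by the Bessel bound, and the compactly supported part contributes
    little because it sees [eta] only near the integers. *)
Lemma coef_energy_vanish f eta (Lam : set R) (C : R) : L2 f -> L2 eta ->
  (forall lambda, Lam lambda -> lambda != 0) ->
  (forall lambda g, Lam lambda -> L2 g -> coef_energy g eta lambda <= C%:E * energy setT g)%E ->
  forall eps : R, 0 < eps -> exists2 delta : R, 0 < delta &
    forall lambda, Lam lambda -> `|lambda| < delta ->
      (coef_energy f eta lambda <= eps%:E)%E.
Proof.
move=> Lf Le Lam0 bessel eps e0.
(* A bound that one can divide by. *)
pose C' := Num.max C 1.
have C'0 : 0 < C' by rewrite lt_max ltr01 orbT.
have [N HN] := energy_tail Lf (divr_gt0 e0 (mulr_gt0 (ltr0Sn R 3) C'0)).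
have [mf foo] := (L2_energy f).1 Lf.
have [me _] := (L2_energy eta).1 Le.
have Ef0 := energy_ge0 setT f.
pose F := fine (energy setT f).
have FE : energy setT f = F%:E by rewrite fineK// ge0_fin_numE.
have F0 : 0 <= F by rewrite fine_ge0.
have F1 : 0 < 8 * (F + 1) by rewrite mulr_gt0// ltr_wpDl.
(* The squared modulus of a sum costs a factor 2, so each of the two parts
   of [f] may contribute eps / 4; for the compactly supported
   part, [coef_energy_trunc_le] brings in the further factor 2 F, where F is
   the energy of [f]. *)
have [n Hn] := energy_near_integers Le (divr_gt0 e0 F1).
exists (n.+2%:R^-1 / N.+1%:R); first by rewrite divr_gt0// invr_gt0.
move=> lambda Ll dl.
have l0 := Lam0 _ Ll.
have cle : `|lambda| * N%:R <= n.+2%:R^-1.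
  apply: (@le_trans _ _ (`|lambda| * N.+1%:R)).
    by rewrite ler_wpM2l// ler_nat.
  by rewrite -ler_pdivlMr// ltW.
have c2 : n.+2%:R^-1 <= 2^-1 :> R by rewrite lef_pV2 ?posrE// ler_nat.
set A := [set x : R | `|x| < N%:R] in HN.
have mA : measurable A by exact: measurable_normr_lt.
have mCA : measurable (~` A) by exact: measurableC.
rewrite (trunc_split A f).
apply: (le_trans (coef_energyD_le l0 (L2_trunc mA Lf) (L2_trunc mCA Lf) Le)).
have h1 : (coef_energy (trunc A f) eta lambda <= (eps / 4)%:E)%E.
  apply: (le_trans (coef_energy_trunc_le l0 Lf Le (le_trans cle c2))).
  have : (energy (near_integers (`|lambda| * N%:R)) eta <= (eps / (8 * (F + 1)))%:E)%E.
    apply: le_trans (ltW Hn); apply: energy_setS => //; try exact: measurable_near_integers.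
    exact: near_integersS.
  move=> H; rewrite FE.
  apply: (@le_trans _ _ (2%:E * (F%:E * (eps / (8 * (F + 1)))%:E))%E).
    by apply: lee_wpmul2l => //; apply: lee_wpmul2l.
  have F1' : F + 1 != 0 by rewrite gt_eqF// ltr_wpDl.
  rewrite -!EFinM lee_fin [leLHS](_ : _ = eps / 4 * (F / (F + 1))); last by field.
  rewrite ler_piMr ?divr_ge0 ?(ltW e0)// ler_pdivrMr ?mul1r ?lerDl//.
  by rewrite ltr_wpDl.
have h2 : (coef_energy (trunc (~` A) f) eta lambda <= (eps / 4)%:E)%E.
  apply: (le_trans (bessel _ _ Ll (L2_trunc mCA Lf))); rewrite energy_trunc.
  apply: (@le_trans _ _ (C'%:E * energy (~` A) f)%E).
    apply: lee_wpmul2r; first exact: energy_ge0.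
    by rewrite lee_fin le_max lexx.
  apply: (@le_trans _ _ (C'%:E * (eps / (4 * C'))%:E)%E).
    by apply: lee_wpmul2l; [rewrite lee_fin ltW|exact: ltW].
  rewrite -EFinM lee_fin; have : C' != 0 by rewrite gt_eqF.
  by move=> ?; rewrite le_eqVlt; apply/orP; left; apply/eqP; field.
apply: (@le_trans _ _ (2%:E * (eps / 4)%:E + 2%:E * (eps / 4)%:E)%E).
  apply: leeD.
    by apply: lee_wpmul2l h1; rewrite lee_fin.
  by apply: lee_wpmul2l h2; rewrite lee_fin.
by rewrite -!EFinM -EFinD lee_fin; lra.
Qed.

End Vanishing.

(** * Series over the integers *)

Section IntegerSums.
Variable R : realType.

Definition ints_from (J : int) : set int := [set j | J <= j].

(** Limits as the level goes to -oo are taken along the levels - n, with n a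
    natural number going to +oo; any finite set of levels is eventually
    reached. *)
Lemma near_oppz_le (s : seq int) :
  \forall n \near \oo, forall j, j \in s -> - (n%:Z) <= j.
Proof.
elim: s => [|i s IHs]; first by near=> n.
near=> n => j; rewrite inE => /orP[/eqP ->|js].
  have : (`|i| <= n)%N by near: n; exact: nbhs_infty_ge.
  by lia.
have H : forall j, j \in s -> - (n%:Z) <= j by near: n.
exact: H.
Unshelve. all: by end_near.
Qed.

Lemma subset_esum (I : choiceType) (A B : set I) (a : I -> \bar R) :
  A `<=` B -> (\esum_(i in A) a i <= \esum_(i in B) a i)%E.
Proof.
move=> AB; apply: le_ereal_sup => x [X [finX XA] <-].
by exists X => //; split => //; exact: subset_trans AB.
Qed.

Lemma esum_int_le (a : int -> \bar R) (M : \bar R) :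
  (forall n : nat, \esum_(j in (ints_from (- n%:Z)%R)) a j <= M)%E ->
  (\esum_(j in [set: int]) a j <= M)%E.
Proof.
move=> H; apply: ge_ereal_sup => _ [X [finX _] <-].
have [n _ /(_ n (leqnn n)) Hn] := near_oppz_le (finmap.enum_fset (fset_set X)).
apply: le_trans (H n); apply: ereal_sup_ubound; exists X => //; split => // j Xj.
by apply: Hn; rewrite in_fset_set// inE.
Qed.

Lemma esum_int_near (a : int -> \bar R) (eps : R) :
  (\esum_(j in [set: int]) a j \is a fin_num)%E -> 0 < eps ->
  \forall n \near \oo, (\esum_(j in [set: int]) a j <=
    \esum_(j in (ints_from (- n%:Z)%R)) a j + eps%:E)%E.
Proof.
move=> fa e0; have [_ [X [finX _] <-] HX] := ub_ereal_sup_adherent e0 fa.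
have := near_oppz_le (finmap.enum_fset (fset_set X)); apply: filterS => n Hn.
rewrite -leeBlDr//; apply: (le_trans (ltW HX)).
apply: ereal_sup_ubound; exists X => //; split => // j Xj.
by apply: Hn; rewrite in_fset_set// inE.
Qed.

Lemma esum_int_shift (J m : int) (a : int -> \bar R) :
  (\esum_(j in (ints_from (J + m)%R)) a j =
   \esum_(j in (ints_from J)) a (j + m)%R)%E.
Proof.
apply: (reindex_esum _ _ (fun j => j + m)); split => /=.
- by move=> j; rewrite /ints_from/= lerD2r.
- by move=> i j _ _; exact: addIr.
- by move=> j Jj; exists (j - m); rewrite ?subrK// /ints_from/= lerBrDr.
Qed.

Lemma csum_int_shift (J m : int) (u : int -> R[i]) :
  csum (ints_from (J + m)%R) u = csum (ints_from J) (fun j => u (j + m)).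
Proof. by rewrite /csum /rsum !esum_int_shift. Qed.

Lemma normr_rsum_le (I : choiceType) (D : set I) (u : I -> R) :
  (`|rsum D u|%:E <= \esum_(i in D) `|u i|%:E)%E.
Proof.
set S := (\esum_(i in D) `|u i|%:E)%E.
have [->|Sfin] := eqVneq S +oo%E; first by rewrite leey.
have S0 : (0 <= S)%E by apply: esum_ge0 => i _; rewrite lee_fin.
have part (w : I -> R) : (forall i, 0 <= w i <= `|u i|) ->
    0 <= fine (\esum_(i in D) (w i)%:E)%E <= fine S.
  move=> Hw; have w0 : (0 <= \esum_(i in D) (w i)%:E)%E.
    by apply: esum_ge0 => i _; rewrite lee_fin; case/andP: (Hw i).
  have wS : (\esum_(i in D) (w i)%:E <= S)%E.
    by apply: le_esum => i _; rewrite lee_fin; case/andP: (Hw i).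
  have fS : S \is a fin_num by rewrite ge0_fin_numE// ltey.
  by rewrite fine_ge0//= fine_le// (@ge0_fin_numE R)// (le_lt_trans wS)// ltey.
rewrite -[leRHS]fineK ?ge0_fin_numE ?ltey// lee_fin /rsum ler_norml.
have max_le (x : R) : 0 <= Num.max x 0 <= `|x|.
  by rewrite le_max lexx orbT ge_max normr_ge0 ler_norm.
have /andP[p0 pS] := part (fun i => Num.max (u i) 0) (fun i => max_le (u i)).
have maxN_le i : 0 <= Num.max (- u i) 0 <= `|u i| by rewrite -normrN max_le.
have /andP[n0 nS] := part (fun i => Num.max (- u i) 0) maxN_le.
by apply/andP; split; lra.
Qed.

(** The sum of an absolutely convergent series is a difference of two
    nonnegative sums, and for these the partial sums from - n upwards come
    within eps of the total. *)
Lemma rsum_int_near (v : int -> R) (eps : R) :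
  (\esum_(j in [set: int]) `|v j|%:E < +oo)%E -> 0 < eps ->
  \forall n \near \oo,
    `|rsum [set: int] v - rsum (ints_from (- n%:Z)) v| <= eps.
Proof.
move=> voo e0.
have part (w : int -> R) : (forall i, 0 <= w i <= `|v i|) ->
    \forall n \near \oo, 0 <= fine (\esum_(j in [set: int]) (w j)%:E)%E -
      fine (\esum_(j in ints_from (- n%:Z)%R) (w j)%:E)%E <= eps.
  move=> Hw; have wfin D : (\esum_(j in D) (w j)%:E)%E \is a fin_num.
    rewrite ge0_fin_numE; last first.
      by apply: esum_ge0 => i _; rewrite lee_fin; case/andP: (Hw i).
    apply: le_lt_trans voo; apply: (le_trans (subset_esum (B := setT) _ _)) => //.
    by apply: le_esum => i _; rewrite lee_fin; case/andP: (Hw i).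
  have := esum_int_near (wfin setT) e0; apply: filterS => n Hn.
  rewrite subr_ge0 lerBlDl -[X in _ <= _ <= X]/(fine (_ %:E)).
  apply/andP; split; first by apply: fine_le => //; exact: subset_esum.
  by rewrite -lee_fin EFinD !fineK.
have max_le (x : R) : 0 <= Num.max x 0 <= `|x|.
  by rewrite le_max lexx orbT ge_max normr_ge0 ler_norm.
have maxN_le i : 0 <= Num.max (- v i) 0 <= `|v i| by rewrite -normrN max_le.
have := part _ (fun i => max_le (v i)); have := part _ maxN_le.
apply: filterS2 => n /andP[n1 n2] /andP[p1 p2].
by rewrite /rsum ler_norml; apply/andP; split; lra.
Qed.

(** Here [p n] is the part of a representation of [x] that is carried by
    levels below - n; when it tends to zero the full series represents
    [x]. *)
Lemma rsum_int_limit (v : int -> R) (p : nat -> R) (x : R) :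
  (\esum_(j in [set: int]) `|v j|%:E < +oo)%E ->
  (forall eps, 0 < eps -> \forall n \near \oo, `|p n| <= eps) ->
  (forall n, x = p n + rsum (ints_from (- n%:Z)) v) ->
  x = rsum [set: int] v.
Proof.
move=> voo p0 xE; apply/eqP; rewrite -subr_eq0 -normr_le0.
apply/ler_addgt0Pr => e e0; rewrite add0r.
have e20 : 0 < e / 2 by rewrite divr_gt0.
have [n _ /(_ n (leqnn n)) [Hp Hv]] := filterI (p0 _ e20) (rsum_int_near voo e20).
rewrite (xE n); move: Hp Hv; rewrite !ler_norml => /andP[h1 h2] /andP[h3 h4].
by apply/andP; split; lra.
Qed.

End IntegerSums.

(** * From nonhomogeneous to homogeneous systems *)

Section Dilation.
Variables (R : realType) (d : R) (d_neq0 : d != 0).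

Let dj_neq0 (j : int) : d ^ j != 0.
Proof. by rewrite expfz_neq0. Qed.

Lemma near_dilation_small : 1 < `|d| -> forall delta : R, 0 < delta ->
  \forall n \near \oo, `|d ^ (- n%:Z)| < delta.
Proof.
move=> d1 delta delta0.
have : `|d^-1| < 1 by rewrite normfV invf_lt1// (lt_trans ltr01).
move=> /cvg_expr /cvgr0_norm_lt /(_ _ delta0); apply: filterS => n.
by rewrite -exprnN exprVn.
Qed.

Lemma inner_dilshiftr f eta lambda nu k : L2 f -> L2 eta ->
  lambda != 0 -> nu != 0 ->
  inner (dilshift f nu 0) (dilshift eta (lambda * nu) k) =
  inner f (dilshift eta lambda k) :> R[i].
Proof.
move=> Lf Le l0 n0; rewrite -dilshift_dilshift inner_dilshift//.
exact: L2_dilshift.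
Qed.

Lemma inner_dilshiftl f eta lambda nu k : L2 f -> L2 eta ->
  lambda != 0 -> nu != 0 ->
  inner (dilshift eta (lambda * nu) k) (dilshift f nu 0) =
  inner (dilshift eta lambda k) f :> R[i].
Proof.
move=> Lf Le l0 n0; rewrite -dilshift_dilshift inner_dilshift//.
exact: L2_dilshift.
Qed.

Lemma coef_energy_dilshift f eta (m j : int) : L2 f -> L2 eta ->
  coef_energy (dilshift f (d ^ m) 0) eta (d ^ (j + m)) = coef_energy f eta (d ^ j).
Proof.
move=> Lf Le; apply: eq_esum => k _.
by rewrite (expfzDr _ _ d_neq0) (inner_dilshiftr k Lf Le (dj_neq0 j) (dj_neq0 m)).
Qed.

Lemma dual_term_dilshift f g eta teta (m j k : int) :
  L2 f -> L2 g -> L2 eta -> L2 teta ->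
  dual_term d (dilshift f (d ^ m) 0) (dilshift g (d ^ m) 0) eta teta (j + m) k =
  dual_term d f g eta teta j k.
Proof.
move=> Lf Lg Le Lt; rewrite /dual_term (expfzDr _ _ d_neq0).
by rewrite (inner_dilshiftr k Lf Le (dj_neq0 j) (dj_neq0 m))
  (inner_dilshiftl k Lg Lt (dj_neq0 j) (dj_neq0 m)).
Qed.

Definition level_energy n (etas : 'I_n -> R -> R[i]) f (j : int) : \bar R :=
  (\sum_(l < n) coef_energy f (etas l) (d ^ j)%R)%E.

Lemma level_energy_ge0 n (etas : 'I_n -> R -> R[i]) f j :
  (0 <= level_energy etas f j)%E.
Proof. by apply: sume_ge0 => l _; exact: coef_energy_ge0. Qed.

(** Dilating [f] by a power of [d] moves its coefficients from one level to
    another without changing them. *)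
Lemma level_energy_dilshift n (etas : 'I_n -> R -> R[i]) f (j m : int) :
  (forall l, L2 (etas l)) -> L2 f ->
  level_energy etas (dilshift f (d ^ m) 0) (j + m) = level_energy etas f j.
Proof. by move=> Le Lf; apply: eq_bigr => l _; exact: coef_energy_dilshift. Qed.

Section Frames.
Variables (r s : nat) (Phi : 'I_r -> R -> R[i]) (Psi : 'I_s -> R -> R[i]).
Hypotheses (Phi_L2 : forall l, L2 (Phi l)) (Psi_L2 : forall l, L2 (Psi l)).

Lemma nonhom_frame_boundsE J C1 C2 : nonhom_frame_bounds d J Phi Psi C1 C2 <->
  forall f, L2 f ->
  (C1%:E * energy setT f <=
     level_energy Phi f J + \esum_(j in ints_from J) level_energy Psi f j)%E /\
  (level_energy Phi f J + \esum_(j in ints_from J) level_energy Psi f j <=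
     C2%:E * energy setT f)%E.
Proof.
by split => H f Lf; move: (H f Lf); cbv zeta; rewrite L2norm_sqr.
Qed.

(** Dilation by [d ^ m] is unitary, and with [m = J - J'] it maps the levels
    from [J'] upwards onto those from [J] upwards.  So the inequality for [f] at [J'] is the one
    for the dilated function at [J]. *)
Lemma nonhom_frame_bounds_shift J J' C1 C2 :
  nonhom_frame_bounds d J Phi Psi C1 C2 -> nonhom_frame_bounds d J' Phi Psi C1 C2.
Proof.
have [m ->] : exists m, J = J' + m by exists (J - J'); rewrite subrKC.
move=> /nonhom_frame_boundsE H; apply/nonhom_frame_boundsE => f Lf.
have [mf _] := (L2_energy f).1 Lf.
have tailE : (\esum_(j in ints_from (J' + m)%R)
      level_energy Psi (dilshift f (d ^ m) 0)%R j =
    \esum_(j in ints_from J') level_energy Psi f j)%E.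
  rewrite esum_int_shift; apply: eq_esum => j _.
  exact: level_energy_dilshift.
have := H _ (L2_dilshift 0 (dj_neq0 m) Lf).
by rewrite (energy_dilshiftT _ (dj_neq0 m) mf) (level_energy_dilshift _ _ Phi_L2 Lf) tailE.
Qed.

(** The frame inequality at level [J] contains a Bessel bound for the
    generators in [Phi] at that level, with the same constant for every
    [J]; hence [coef_energy_vanish] applies to all the dilations
    [d ^ J]. *)
Lemma scaling_energy_vanish C1 C2 f : 1 < `|d| ->
  (forall J, nonhom_frame_bounds d J Phi Psi C1 C2) -> L2 f ->
  forall eps, 0 < eps -> \forall n \near \oo,
    (level_energy Phi f (- n%:Z)%R <= eps%:E)%E.
Proof.
move=> d1 H Lf eps e0.
have bessel l lambda g : range (fun j => d ^ j) lambda -> L2 g ->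
    (coef_energy g (Phi l) lambda <= C2%:E * energy setT g)%E.
  move=> [J _ <-] Lg; have [_] := (nonhom_frame_boundsE J C1 C2).1 (H J) g Lg.
  apply: le_trans; apply: (@le_trans _ _ (level_energy Phi g J)%E).
    rewrite /level_energy (bigD1 l)//=; apply: leeDl.
    by apply: sume_ge0 => i _; exact: coef_energy_ge0.
  by apply: leeDl; apply: esum_ge0 => j _; exact: level_energy_ge0.
have er0 : 0 < eps / r.+1%:R by rewrite divr_gt0.
have van l : \forall n \near \oo,
    (coef_energy f (Phi l) (d ^ (- n%:Z))%R <= (eps / r.+1%:R)%:E)%E.
  have [|delta delta0 Hd] := coef_energy_vanish Lf (Phi_L2 l) _ (bessel l) er0.
    by move=> _ [j _ <-].
  have := near_dilation_small d1 delta0; apply: filterS => n; apply: Hd.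
  by exists (- n%:Z).
have : \forall n \near \oo, forall l,
    (coef_energy f (Phi l) (d ^ (- n%:Z))%R <= (eps / r.+1%:R)%:E)%E.
  exact: filter_forall.
apply: filterS => n Hn.
apply: (@le_trans _ _ (\sum_(l < r) (eps / r.+1%:R)%:E)%E).
  by apply: lee_sum => l _; exact: Hn.
rewrite sumEFin lee_fin sumr_const card_ord -[leLHS]mulr_natr mulrAC -mulrA.
by rewrite ler_piMr ?(ltW e0)// ler_pdivrMr// mul1r ler_nat.
Qed.

(** As [J] goes to -oo the sums over the levels from [J] upwards increase to
    the full sum, which settles the upper bound; the lower bound survives
    because the energy carried by [Phi] disappears. *)
Lemma hom_frame_bounds_limit C1 C2 : 1 < `|d| ->
  (forall J, nonhom_frame_bounds d J Phi Psi C1 C2) ->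
  hom_frame_bounds d Psi C1 C2.
Proof.
move=> d1 H f Lf; cbv zeta; rewrite L2norm_sqr; split.
- apply/lee_addgt0Pr => e e0.
  have [n _ /(_ n (leqnn n)) Hn] := scaling_energy_vanish d1 H Lf e0.
  have [+ _] := (nonhom_frame_boundsE (- n%:Z) C1 C2).1 (H _) f Lf.
  move=> /le_trans; apply; rewrite addeC; apply: leeD => //.
  exact: subset_esum.
- apply: esum_int_le => n.
  have [_] := (nonhom_frame_boundsE (- n%:Z) C1 C2).1 (H _) f Lf.
  apply: le_trans; apply: leeDr; exact: level_energy_ge0.
Qed.

End Frames.

Lemma hom_frame_of_nonhom r s (Phi : 'I_r -> R -> R[i]) (Psi : 'I_s -> R -> R[i]) J :
  (forall l, L2 (Phi l)) -> (forall l, L2 (Psi l)) -> 1 < `|d| ->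
  nonhom_frame d J Phi Psi -> hom_frame d Psi.
Proof.
move=> LPhi LPsi d1 [C1 [C2 [C10 C20 H]]]; exists C1, C2; split => //.
apply: (hom_frame_bounds_limit LPhi d1) => J'.
exact: (nonhom_frame_bounds_shift _ _ _ H).
Qed.

Lemma dual_term_le f g eta teta (j k : int) : L2 f -> L2 g -> L2 eta -> L2 teta ->
  cabs (dual_term d f g eta teta j k) <=
  cabs (inner f (dilshift eta (d ^ j) k)) ^+ 2 +
  cabs (inner g (dilshift teta (d ^ j) k)) ^+ 2.
Proof.
move=> Lf Lg Le Lt; apply: (le_trans (cabs_mul_le _ _)).
by rewrite (cabs_innerC (g := g))//; exact: L2_dilshift.
Qed.

Lemma esum_dual_term_le f g eta teta (j : int) :
  L2 f -> L2 g -> L2 eta -> L2 teta ->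
  (\esum_(k in [set: int]) (cabs (dual_term d f g eta teta j k))%:E <=
   coef_energy f eta (d ^ j) + coef_energy g teta (d ^ j))%E.
Proof.
move=> Lf Lg Le Lt; rewrite /coef_energy -esumD; last 2 first.
- by move=> k _; rewrite lee_fin sqr_ge0.
- by move=> k _; rewrite lee_fin sqr_ge0.
by apply: le_esum => k _; rewrite -EFinD lee_fin dual_term_le.
Qed.

Definition level_pairing n (etas tetas : 'I_n -> R -> R[i]) f g (j : int) : R[i] :=
  \sum_(l < n) csum [set: int] (dual_term d f g (etas l) (tetas l) j).

Lemma level_pairing_dilshift n (etas tetas : 'I_n -> R -> R[i]) f g (j m : int) :
  (forall l, L2 (etas l)) -> (forall l, L2 (tetas l)) -> L2 f -> L2 g ->
  level_pairing etas tetas (dilshift f (d ^ m) 0) (dilshift g (d ^ m) 0) (j + m) =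
  level_pairing etas tetas f g j.
Proof.
move=> Le Lt Lf Lg; apply: eq_bigr => l _; congr csum.
by apply/funext => k; exact: dual_term_dilshift.
Qed.

Lemma level_cabs_le n (etas tetas : 'I_n -> R -> R[i]) f g (j : int) :
  (forall l, L2 (etas l)) -> (forall l, L2 (tetas l)) -> L2 f -> L2 g ->
  (\sum_(l < n) \esum_(k in [set: int])
     (cabs (dual_term d f g (etas l) (tetas l) j k))%:E <=
   level_energy etas f j + level_energy tetas g j)%E.
Proof.
move=> Le Lt Lf Lg; rewrite /level_energy -big_split/=.
by apply: lee_sum => l _; exact: esum_dual_term_le.
Qed.

(** The real and the imaginary part, described by the properties that carry
    the limit of the dual expansion, which is thus taken once for both. *)
Definition component (c : R[i] -> R) : Prop :=
  [/\ {morph c : x y / x + y}, c 0 = 0, forall z, `|c z| <= cabs z &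
      forall D (u : int -> R[i]), c (csum D u) = rsum D (c \o u)].

Lemma component_Re : component (@complex.Re R).
Proof. by split => //; [exact: ReD|exact: normr_Re_le]. Qed.

Lemma component_Im : component (@complex.Im R).
Proof. by split => //; [exact: ImD|exact: normr_Im_le]. Qed.

Lemma level_pairing_le c n (etas tetas : 'I_n -> R -> R[i]) f g (j : int) :
  component c ->
  (forall l, L2 (etas l)) -> (forall l, L2 (tetas l)) -> L2 f -> L2 g ->
  (`|c (level_pairing etas tetas f g j)|%:E <=
   level_energy etas f j + level_energy tetas g j)%E.
Proof.
move=> [cD c0 cle csumE] Le Lt Lf Lg.
apply: le_trans (level_cabs_le j Le Lt Lf Lg).
rewrite /level_pairing (big_morph c cD c0).
apply: (@le_trans _ _ (\sum_(l < n)
  `|c (csum [set: int] (dual_term d f g (etas l) (tetas l) j))|%:E)%E).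
  by rewrite sumEFin lee_fin ler_norm_sum.
apply: lee_sum => l _; rewrite csumE; apply: (le_trans (normr_rsum_le _ _)).
by apply: le_esum => k _; rewrite lee_fin; exact: cle.
Qed.

Section DualFrames.
Variables (r s : nat) (Phi tPhi : 'I_r -> R -> R[i]) (Psi tPsi : 'I_s -> R -> R[i]).
Hypotheses (Phi_L2 : forall l, L2 (Phi l)) (Psi_L2 : forall l, L2 (Psi l)).
Hypotheses (tPhi_L2 : forall l, L2 (tPhi l)) (tPsi_L2 : forall l, L2 (tPsi l)).

Definition reproduces (J : int) : Prop := forall f g, L2 f -> L2 g ->
  inner f g = level_pairing Phi tPhi f g J +
    csum (ints_from J) (level_pairing Psi tPsi f g).

(** Same unitarity argument as for the frame bounds, applied to both entries
    of the sesquilinear identity. *)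
Lemma reproduces_shift J J' : reproduces J -> reproduces J'.
Proof.
have [m ->] : exists m, J = J' + m by exists (J - J'); rewrite subrKC.
move=> H f g Lf Lg; have dm := dj_neq0 m.
rewrite -(inner_dilshift 0 dm Lf Lg).
rewrite (H _ _ (L2_dilshift 0 dm Lf) (L2_dilshift 0 dm Lg)).
have tailE : (fun j => level_pairing Psi tPsi (dilshift f (d ^ m) 0)
    (dilshift g (d ^ m) 0) (j + m)) = level_pairing Psi tPsi f g.
  by apply/funext => j; exact: level_pairing_dilshift.
by rewrite csum_int_shift tailE (level_pairing_dilshift _ _ Phi_L2 tPhi_L2 Lf Lg).
Qed.

(** Each dual term is at most the sum of the two squared coefficients, so the
    frame bounds of the homogeneous systems give absolute convergence, and the
    contribution of [Phi] and [tPhi] at level [J] tends to zero with their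
    energies. *)
Lemma hom_reproduces f g : 1 < `|d| ->
  (exists C1 C2, forall J, nonhom_frame_bounds d J Phi Psi C1 C2) ->
  (exists C1 C2, forall J, nonhom_frame_bounds d J tPhi tPsi C1 C2) ->
  (forall J, reproduces J) -> L2 f -> L2 g ->
  (\esum_(j in [set: int]) (level_energy Psi f j + level_energy tPsi g j) < +oo)%E /\
  inner f g = csum [set: int] (level_pairing Psi tPsi f g).
Proof.
move=> d1 [C1 [C2 H]] [D1 [D2 tH]] rep Lf Lg.
have fin : (\esum_(j in [set: int])
    (level_energy Psi f j + level_energy tPsi g j) < +oo)%E.
  rewrite esumD; last 2 first.
  - by move=> j _; exact: level_energy_ge0.
  - by move=> j _; exact: level_energy_ge0.
  have [_] := hom_frame_bounds_limit Phi_L2 d1 H Lf.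
  have [_] := hom_frame_bounds_limit tPhi_L2 d1 tH Lg.
  have [_ foo] := (L2_energy f).1 Lf; have [_ goo] := (L2_energy g).1 Lg.
  rewrite !L2norm_sqr => Hg Hf; apply: lte_add_pinfty.
    apply: (le_lt_trans Hf).
    by rewrite -[energy _ _]fineK ?ge0_fin_numE ?energy_ge0// -EFinM ltry.
  apply: (le_lt_trans Hg).
  by rewrite -[energy _ _]fineK ?ge0_fin_numE ?energy_ge0// -EFinM ltry.
split => //.
have low eps : 0 < eps -> \forall n \near \oo,
    (level_energy Phi f (- n%:Z)%R + level_energy tPhi g (- n%:Z)%R <= eps%:E)%E.
  move=> e0; have e20 : 0 < eps / 2 by rewrite divr_gt0.
  have h1 := scaling_energy_vanish Phi_L2 d1 H Lf e20.
  have h2 := scaling_energy_vanish tPhi_L2 d1 tH Lg e20.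
  have -> : (eps%:E = (eps / 2)%:E + (eps / 2)%:E)%E by rewrite -EFinD -splitr.
  move: h1 h2; apply: filterS2 => n; exact: leeD.
have comp c : component c -> c (inner f g) = c (csum [set: int] (level_pairing Psi tPsi f g)).
  move=> cc; have [cD c0 cle csumE] := cc; rewrite csumE.
  apply: (rsum_int_limit (p := fun n => c (level_pairing Phi tPhi f g (- n%:Z)))).
  - apply: le_lt_trans fin; apply: le_esum => j _; exact: level_pairing_le.
  - move=> eps e0; have := low _ e0; apply: filterS => n leps; rewrite -lee_fin.
    apply: le_trans leps; exact: level_pairing_le.
  - by move=> n; rewrite (rep (- n%:Z) f g Lf Lg) cD csumE.
have := comp _ component_Re; have := comp _ component_Im.
by case: (inner f g) => a b; case: (csum _ _) => a' b' /= -> ->.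
Qed.

End DualFrames.

End Dilation.

Theorem theorem9 (R : realType) (d : R) (d_neq0 : d != 0) (r s : nat)
  (Phi tPhi : 'I_r -> R -> R[i]) (Psi tPsi : 'I_s -> R -> R[i])
  (Phi_L2 : forall l, L2 (Phi l)) (Psi_L2 : forall l, L2 (Psi l))
  (tPhi_L2 : forall l, L2 (tPhi l)) (tPsi_L2 : forall l, L2 (tPsi l)) :
  (forall C1 C2 : R, 0 < C1 -> 0 < C2 ->
     (exists J : int, nonhom_frame_bounds d J Phi Psi C1 C2) ->
     (forall J : int, nonhom_frame_bounds d J Phi Psi C1 C2) /\
     (1 < `|d| -> hom_frame_bounds d Psi C1 C2)) /\
  (1 < `|d| ->
     (exists J : int, nonhom_dual_frames d J Phi Psi tPhi tPsi) ->
     hom_dual_frames d Psi tPsi).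
Proof.
split.
  move=> C1 C2 _ _ [J H].
  have all_J J' : nonhom_frame_bounds d J' Phi Psi C1 C2.
    exact: (nonhom_frame_bounds_shift d_neq0 Phi_L2 Psi_L2 _ H).
  split => // d1; exact: (hom_frame_bounds_limit d_neq0 Phi_L2 d1 all_J).
move=> d1 [J [frame tframe dual]]; split.
- exact: (hom_frame_of_nonhom d_neq0 Phi_L2 Psi_L2 d1 frame).
- exact: (hom_frame_of_nonhom d_neq0 tPhi_L2 tPsi_L2 d1 tframe).
have [C1 [C2 [_ _ H]]] := frame; have [D1 [D2 [_ _ tH]]] := tframe.
have rep : reproduces d Phi tPhi Psi tPsi J by move=> f g Lf Lg; exact: (dual f g Lf Lg).2.
move=> f g Lf Lg.
have [fin innerE] := hom_reproduces d_neq0 Phi_L2 Psi_L2 tPhi_L2 tPsi_L2 d1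
  (ex_intro _ C1 (ex_intro _ C2
    (fun J' => nonhom_frame_bounds_shift d_neq0 Phi_L2 Psi_L2 J' H)))
  (ex_intro _ D1 (ex_intro _ D2
    (fun J' => nonhom_frame_bounds_shift d_neq0 tPhi_L2 tPsi_L2 J' tH)))
  (fun J' => reproduces_shift d_neq0 Phi_L2 Psi_L2 tPhi_L2 tPsi_L2 J' rep) Lf Lg.
split; last exact: innerE.
apply: le_lt_trans fin; apply: le_esum => j _; exact: level_cabs_le.
Qed.
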